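(* $S_w(n,2) = \Theta(n^2)$; that is, there are constants $c, C > 0$ such that $c n^2 \leq S_w(n,2) \leq C n^2$ for all sufficiently large $n$.
   Context: Permutation Mastermind on $n \geq 2$: a secret $\sigma^\star \in S_n$ is chosen; a guess $\pi \in S_n$ receives the black-peg score $b(\pi,\sigma^\star) := |\{i \in [n] : \pi(i) = \sigma^\star(i)\}|$. A static strategy is a fixed list of guesses $(\pi_1,\dots,\pi_T)$ announced in advance; the codemaker then reveals all the scores $b(\pi_t,\sigma^\star)$, after which the codebreaker makes one final guess, which must equal $\sigma^\star$ for the strategy to be correct (for every $\sigma^\star$). For $\pi,\sigma\in S_n$ let $D(\pi,\sigma) := \{i : \pi(i)\neq\sigma(i)\}$. A static strategy is $w_k$-local if for all $1 \le t < T$, $\max D(\pi_t,\pi_{t+1}) - \min D(\pi_t,\pi_{t+1}) \leq k-1$ (i.e. consecutive guesses differ only inside a window of $k$ consecutive positions); the final guess is not subject to this restriction. $S_w(n,k)$ is the minimum length $T$ of the list of a correct $w_k$-local static strategy. *)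

(* Defs.v *)
From HB Require Import structures.
From mathcomp Require Import all_boot all_order all_fingroup all_algebra.
From mathcomp Require Import reals.

Set Implicit Arguments.
Unset Strict Implicit.
Unset Printing Implicit Defensive.

Import Order.TTheory GRing.Theory Num.Theory.

(* Positions and colours are 0, ..., n-1 instead of 1, ..., n. *)

Definition black_pegs (n : nat) (pi sigma : 'S_n) : nat :=
  #|[set i | pi i == sigma i]|.

Definition diff_set (n : nat) (pi sigma : 'S_n) : {set 'I_n} :=
  [set i | pi i != sigma i].

Definition max_pos (n : nat) (A : {set 'I_n}) : nat := \max_(i in A) (i : nat).

(* The idle value n exceeds every position, so this is the minimum of any
   nonempty A. *)
Definition min_pos (n : nat) (A : {set 'I_n}) : nat :=
  \big[minn/n]_(i in A) (i : nat).

(* When pi = sigma the truncated difference is 0 - n = 0: repeating a guess is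
   a legal step. *)
Definition window_step (n k : nat) (pi sigma : 'S_n) : bool :=
  max_pos (diff_set pi sigma) - min_pos (diff_set pi sigma) <= k - 1.

Definition window_local (n k : nat) (guesses : seq 'S_n) : bool :=
  sorted (window_step k) guesses.

(* [final] is the codebreaker's rule for the last guess: a function of the
   scores alone, since the list of guesses is fixed in advance. *)
Definition correct_static (n : nat) (guesses : seq 'S_n) : Prop :=
  exists final : seq nat -> 'S_n, forall sigma : 'S_n,
    final [seq black_pegs pi sigma | pi <- guesses] = sigma.

Definition static_length (n k T : nat) : Prop :=
  exists guesses : seq 'S_n,
    [/\ size guesses = T, window_local k guesses & correct_static guesses].

(* S_w(n, k) = T.  A relation rather than a function of n and k because for
   some k (for instance k = 1 and n >= 3) no correct strategy exists. *)
Definition S_w_is (n k T : nat) : Prop :=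
  static_length n k T /\ forall T' : nat, static_length n k T' -> T <= T'.

(* Main.v *)
(* Lower bound: if two rows had two common colours [c], [d] that no guess ever
   places in either row, exchanging [c] and [d] would be invisible.  So any two
   rows together see at least n - 1 colours, hence about n^2 / 2 pairs (position,
   colour) must occur in the guesses, while every step adds at most two.

   Upper bound: sweep the first colour to the last position by adjacent swaps,
   and repeat n times; this costs n^2 guesses.  Colours being residues mod n,
   the swaps of positions i, i + 1 exchange the colours p and p + i + 1 for every
   p, so the scores give d (p + i + 1) - d p, where d is the indicator of
   sigma i minus that of sigma (i + 1).  Thus two secrets with equal scores have
   d's that differ by a function of period i + 1; unless 2 (i + 1) = n, the
   period has orbits of length at least 3 and the difference, being positive at
   no more than two points, leaves sigma i and sigma (i + 1) unchanged. *)

Require Import Defs.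
From HB Require Import structures.
From mathcomp Require Import all_boot all_order all_fingroup all_algebra.
From mathcomp Require Import zify ring lra boolp.
From mathcomp Require Import reals.

Set Implicit Arguments.
Unset Strict Implicit.
Unset Printing Implicit Defensive.

Import Order.TTheory GRing.Theory Num.Theory.
Local Open Scope ring_scope.

(** * Scores under a swap of two positions, and steps in windows of length 2 *)

Lemma black_pegs_split (n : nat) (pi sigma : 'S_n) (i j : 'I_n) : i != j ->
  black_pegs pi sigma = ((pi i == sigma i) + (pi j == sigma j) +
    \sum_(k | (k != i) && (k != j)) (pi k == sigma k : nat))%N.
Proof.
move=> ij; have -> : black_pegs pi sigma = (\sum_k (pi k == sigma k : nat))%N.
  rewrite /black_pegs -sum1_card big_mkcond /=.
  by apply: eq_bigr => k _; rewrite inE; case: eqP.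
by rewrite (bigD1 i) //= (bigD1 j) ?(eq_sym j) //= addnA.
Qed.

(** What the score gains when colour [c] moves from position [j] to position [i]. *)
Definition swap_gain (n : nat) (sigma : 'S_n) (i j c : 'I_n) : int :=
  (c == sigma i)%:Z - (c == sigma j)%:Z.

Lemma black_pegs_swap (n : nat) (pi sigma : 'S_n) (i j : 'I_n) : i != j ->
  (black_pegs (tperm i j * pi)%g sigma)%:Z - (black_pegs pi sigma)%:Z =
  swap_gain sigma i j (pi j) - swap_gain sigma i j (pi i).
Proof.
move=> ij; rewrite !(black_pegs_split _ _ ij) !permM tpermL tpermR.
rewrite (eq_bigr (fun k => (pi k == sigma k) : nat)); last first.
  by move=> k /andP[ki kj]; rewrite permM tpermD // eq_sym.
rewrite /swap_gain !PoszD; ring.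
Qed.

Definition scores (n : nat) (gs : seq 'S_n) (sigma : 'S_n) : seq nat :=
  [seq black_pegs pi sigma | pi <- gs].

Lemma correct_staticP (n : nat) (gs : seq 'S_n) :
  correct_static gs <-> injective (scores gs).
Proof.
split=> [[final finalE] sigma tau eq_sc|inj].
  by rewrite -(finalE sigma) -/(scores gs sigma) eq_sc finalE.
(* The default [1] answers score lists that no secret produces. *)
exists (fun s => odflt 1%g [pick sigma | scores gs sigma == s]) => sigma.
by case: pickP => [tau /eqP/inj //|/(_ sigma)]; rewrite eqxx.
Qed.

Lemma window_step2_card (n : nat) (pi sigma : 'S_n) :
  window_step 2 pi sigma -> (#|diff_set pi sigma| <= 2)%N.
Proof.
rewrite /window_step; set A := diff_set _ _ => hw.
have Amax i : i \in A -> (i <= max_pos A)%N.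
  by move=> iA; rewrite /max_pos (bigD1 i) //= leq_maxl.
have Amin i : i \in A -> (min_pos A <= i)%N.
  move=> iA; rewrite /min_pos; have := mem_index_enum i.
  elim: (index_enum _) => //= k s IH; rewrite inE big_cons.
  case/predU1P => [<-|/IH le_i]; first by rewrite iA geq_minl.
  by case: ifP => // _; apply: leq_trans le_i; apply: geq_minr.
(* A position in [A] is the minimum or its successor, so testing for the minimum embeds [A] into
   [bool]. *)
rewrite -card_bool -(@card_in_imset _ _ (fun i : 'I_n => (i : nat) == min_pos A)).
  exact: max_card.
move=> i j iA jA /= eq_ij; apply: val_inj => /=.
move: (Amax _ iA) (Amin _ iA) (Amax _ jA) (Amin _ jA) eq_ij hw.
by case: eqP; case: eqP; lia.
Qed.

Lemma window_step2_tperm (n : nat) (pi : 'S_n) (i j : 'I_n) :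
  (i <= j <= i.+1)%N -> window_step 2 pi (tperm i j * pi)%g.
Proof.
move=> /andP[ij ji]; rewrite /window_step.
have Aij k : k \in diff_set pi (tperm i j * pi)%g -> (i <= k <= j)%N.
  by rewrite inE permM; case: tpermP => [->|->|]; rewrite ?eqxx ?leqnn ?ij.
move: (diff_set _ _) Aij => A Aij.
have maxA : (max_pos A <= j)%N by apply/bigmax_leqP => k /Aij/andP[].
suff: (i <= min_pos A)%N by lia.
rewrite /min_pos; elim/big_ind: _ => [|x y ix iy|k /Aij/andP[]//].
  exact: ltnW.
by rewrite leq_min ix.
Qed.

(** * Lower bound *)

Definition guessed (n : nat) (gs : seq 'S_n) (i c : 'I_n) : bool :=
  has (fun pi : 'S_n => pi i == c) gs.

Definition num_guessed (n : nat) (gs : seq 'S_n) (i : 'I_n) : nat :=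
  (\sum_c guessed gs i c)%N.

Lemma sum_num_guessed_le (n : nat) (gs : seq 'S_n) : window_local 2 gs ->
  (\sum_i num_guessed gs i <= n + 2 * size gs)%N.
Proof.
have sum1b (a : 'I_n) : (\sum_c (a == c : nat))%N = 1%N.
  by rewrite (bigD1 a) //= eqxx big1 // => c; rewrite eq_sym => /negPf->.
case: gs => [|pi gs].
  by move=> _; rewrite big1 // => i _; rewrite /num_guessed big1.
rewrite /window_local /=.
elim: gs pi => [|pi' gs IH] pi /=.
  move=> _; rewrite (eq_bigr (fun=> 1%N)) => [|i _].
    by rewrite sum_nat_const card_ord muln1 leq_addr.
  rewrite /num_guessed -(sum1b (pi i)); apply: eq_bigr => c _.
  by rewrite /guessed /= orbF.
move=> /andP[/window_step2_card card2 /IH{}IH].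
have -> : (n + 2 * (size gs).+2 = n + 2 * (size gs).+1 + 2)%N by lia.
(* Prepending [pi] gives row [i] at most the new colour [pi i], and none where [pi] and [pi'] agree:
   new pairs are charged to the difference set. *)
apply: leq_trans (leq_add IH card2).
rewrite -sum1_card (big_mkcond (fun i => i \in _)) /= -big_split /=.
apply: leq_sum => i _; rewrite inE /num_guessed.
case: eqVneq => [eq_i|_] /=.
  rewrite addn0; apply: leq_sum => c _.
  by rewrite /guessed /= eq_i orbA orbb.
rewrite -(sum1b (pi i)) -big_split /=; apply: leq_sum => c _.
by rewrite /guessed /=; case: (pi i == c); case: (pi' i == c); case: (has _ _).
Qed.

Lemma exists_perm2 (n : nat) (i j c d : 'I_n) : i != j -> c != d ->
  exists sigma : 'S_n, sigma i = c /\ sigma j = d.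
Proof.
move=> ij cd; exists (tperm i c * tperm (tperm i c j) d)%g.
rewrite !permM tpermL [in X in _ /\ X]tpermL; split=> //.
apply: tpermD; last by rewrite eq_sym.
by rewrite -[X in _ != X](tpermL i c) (inj_eq perm_inj) eq_sym.
Qed.

(* Otherwise exchanging the two unguessed colours of rows [i] and [j] leaves
   every score unchanged. *)
Lemma unguessed_uniq (n : nat) (gs : seq 'S_n) (i j c d : 'I_n) :
  correct_static gs -> i != j ->
  ~~ guessed gs i c -> ~~ guessed gs j c ->
  ~~ guessed gs i d -> ~~ guessed gs j d -> c = d.
Proof.
move=> /correct_staticP inj ij; rewrite -!all_predC => /allP ic /allP jc.
move=> /allP id /allP jd.
apply/eqP/negPn/negP => cd; have [sigma [si sj]] := exists_perm2 ij cd.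
suff /inj/permP/(_ i) : scores gs sigma = scores gs (tperm i j * sigma)%g.
  by rewrite permM tpermL si sj => /eqP; apply/negP.
apply/eq_in_map => pi pig; rewrite !(black_pegs_split _ _ ij) !permM.
rewrite tpermL tpermR si sj.
rewrite (negPf (ic _ pig)) (negPf (jc _ pig)) (negPf (id _ pig)).
rewrite (negPf (jd _ pig)); congr addn; apply: eq_bigr => k /andP[ki kj].
by rewrite permM tpermD // eq_sym.
Qed.

Lemma num_guessed_pair (n : nat) (gs : seq 'S_n) (i j : 'I_n) :
  correct_static gs -> i != j ->
  (n.-1 <= num_guessed gs i + num_guessed gs j)%N.
Proof.
move=> corr ij; rewrite /num_guessed -big_split /=.
pose U := [set c | ~~ guessed gs i c && ~~ guessed gs j c].
have U1 : (#|U| <= 1)%N.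
  apply/card_le1_eqP => c d; rewrite !inE => /andP[ic jc] /andP[id jd].
  by rewrite (unguessed_uniq corr ij ic jc id jd).
suff: (#|~: U| <= \sum_c (guessed gs i c + guessed gs j c))%N.
  apply: leq_trans; rewrite -subn1 leq_subLR -{1}(card_ord n) -(cardsC U).
  by rewrite leq_add2r.
rewrite -sum1_card big_mkcond; apply: leq_sum => c _; rewrite !inE.
by case: (guessed gs i c); case: (guessed gs j c).
Qed.

Lemma static_length_ge (n T : nat) : (4 <= n)%N -> static_length n 2 T ->
  (n ^ 2 <= 16 * T)%N.
Proof.
case: n => [|[|n]] // n4 [gs [<- loc corr]].
have := sum_num_guessed_le loc; set S := (\sum_i _)%N => le_S.
have : (n.+2 * n.+1 <= S + S)%N.
  (* Each row is paired with its cyclic successor, so every row is counted twice. *)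
  rewrite {2}/S (reindex_inj (addrI (1 : 'I_n.+2))) /= -big_split /=.
  rewrite -{1}(card_ord n.+2) -sum_nat_const.
  apply: leq_sum => i _; apply: (num_guessed_pair corr).
  by rewrite eq_sym -subr_eq0 addrK oner_eq0.
(* n(n - 1) <= 2S <= 2n + 4T gives n^2 - 3n <= 4T, and n^2 <= 4(n^2 - 3n) once n >= 4. *)
by nia.
Qed.

(** * Upper bound *)

Section Sweeps.

Variable m : nat.
Notation n := m.+2.

(** The cycle 0 -> 1 -> ... -> i -> 0, built one adjacent swap at a time. *)
Fixpoint cycle_perm (i : nat) : 'S_n :=
  if i is i'.+1 then (tperm (inord i') (inord i) * cycle_perm i')%g else 1%g.

Lemma cycle_permE (i : nat) (k : 'I_n) : (i < n)%N ->
  cycle_perm i k =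
    if (k < i)%N then k + 1 else if k == i :> nat then 0 else k.
Proof.
elim: i k => [|i IH] k lt_i.
  by rewrite perm1; case: eqP => // k0; apply: val_inj.
have {}IH l := IH l (ltnW lt_i).
have vi : (inord i : 'I_n) = i :> nat by rewrite inordK // ltnW.
have vi1 : (inord i.+1 : 'I_n) = i.+1 :> nat by rewrite inordK.
rewrite /= permM; case: tpermP => [->|->|ki ki1].
- rewrite IH vi vi1 ltnS leqnn ltnNge leqnSn /=.
  rewrite eqn_leq ltnn /=; apply: val_inj => /=.
  by rewrite vi vi1 (modn_small (m := 1%N)) // addn1 modn_small.
- by rewrite IH vi vi1 ltnn !eqxx ltnn.
- have {ki}ki : (k : nat) != i.
    by apply/eqP => e; apply: ki; apply: val_inj; rewrite /= e vi.
  have {ki1}ki1 : (k : nat) != i.+1.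
    by apply/eqP => e; apply: ki1; apply: val_inj; rewrite /= e vi1.
  by rewrite IH ltnS (negPf ki) (negPf ki1) (leq_eqVlt k) (negPf ki).
Qed.

(* Sweep [p] starts from the rotation by [p] and carries colour [p] from the
   first position to the last, which produces the rotation by [p + 1]. *)
Definition sweep (p : 'I_n) (i : nat) : 'S_n :=
  (cycle_perm i * perm (addrI p))%g.

Lemma sweepE (p : 'I_n) (i : nat) (k : 'I_n) :
  sweep p i k = p + cycle_perm i k.
Proof. by rewrite permM permE. Qed.

Lemma sweepS (p : 'I_n) (i : nat) :
  sweep p i.+1 = (tperm (inord i) (inord i.+1) * sweep p i)%g.
Proof. by rewrite /sweep mulgA. Qed.

(** Once colour [p] is last, the cycle is a full rotation; consecutive sweeps thus meet in a
    repeated guess, which is a legal step. *)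
Lemma sweep_next (p : 'I_n) : sweep (p + 1) 0 = sweep p m.+1.
Proof.
apply/permP => k; rewrite !sweepE perm1 cycle_permE //.
case: ltngtP => [_|lt_k|k_max]; first by rewrite -addrA (addrC 1).
- by have := ltn_ord k; rewrite ltnNge lt_k.
- rewrite addr0; have -> : k = m.+1%:R.
    by apply: val_inj; rewrite Zp_nat /= modn_small.
  rewrite -addrA nat1r Zp_nat (_ : inZp _ = 0) ?addr0 //.
  by apply: val_inj; rewrite /= modnn.
Qed.

Definition sweep_guesses : seq 'S_n :=
  mkseq (fun t => sweep (t %/ n)%:R (t %% n)) (n * n).

Lemma window_local_sweep_guesses : window_local 2 sweep_guesses.
Proof.
apply/(sortedP 1%g) => t; rewrite size_mkseq => lt_t.
rewrite !nth_mkseq // 1?ltnW //.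
have [lt_n|ge_n] := ltnP (t %% n).+1 n.
  have [-> ->] : (t.+1 %/ n = t %/ n)%N /\ (t.+1 %% n = (t %% n).+1)%N.
    rewrite {1 3}(divn_eq t n) -addnS.
    by rewrite divnMDl // modnMDl (divn_small lt_n) (modn_small lt_n) addn0.
  rewrite sweepS; apply: window_step2_tperm.
  by rewrite !inordK ?leqnn ?leqnSn // ltnW.
have tm : (t %% n = m.+1)%N by have := ltn_pmod t (isT : 0 < n)%N; lia.
have [-> ->] : (t.+1 %/ n = (t %/ n).+1)%N /\ (t.+1 %% n = 0)%N.
  rewrite {1 3}(divn_eq t n) -addnS tm.
  by rewrite divnMDl // modnMDl divnn modnn addn1.
rewrite tm -natr1 sweep_next -[X in window_step 2 _ X]mul1g -(tperm1 (0 : 'I_n)).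
by apply: window_step2_tperm; rewrite leqnn leqnSn.
Qed.

Lemma mem_sweep_guesses (p : 'I_n) (i : nat) :
  (i < n)%N -> sweep p i \in sweep_guesses.
Proof.
move=> lt_i; apply/mapP; exists (p * n + i)%N.
  by rewrite mem_iota add0n /=; have := ltn_ord p; nia.
by rewrite divnMDl // modnMDl divn_small // modn_small // addn0 natr_Zp.
Qed.

End Sweeps.

(* The difference of the two gains is at least 1 at [a] if [a != a'], hence by
   periodicity also at [a + s] and [a + 2s]; but it is positive only at [a] and
   [b']. *)
Lemma periodic_gain_eq (V : zmodType) (s a b a' b' : V) :
  s != 0 -> s + s != 0 -> a != b ->
  (forall c, (c + s == a)%:Z - (c + s == b)%:Z - (c + s == a')%:Z
      + (c + s == b')%:Z =
    (c == a)%:Z - (c == b)%:Z - (c == a')%:Z + (c == b')%:Z) ->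
  a = a'.
Proof.
move=> s0 ss0 ab per; apply/eqP/negPn/negP => aa'.
have h0 := per a; have h1 := per (a + s).
move: h0 h1; rewrite eqxx (negPf ab) (negPf aa').
have -> : (a + s == a) = false by rewrite -subr_eq0 addrC addKr (negPf s0).
have -> : (a + s + s == a) = false.
  by rewrite -subr_eq0 addrC -addrA addKr (negPf ss0).
have [<-|] := eqVneq (a + s) b'; last by do !case: (_ == _).
have -> : (a + s + s == a + s) = false.
  by rewrite -subr_eq0 addrC addKr (negPf s0).
by do !case: (_ == _).
Qed.

Lemma sweep_scores_eq (m : nat) (sigma tau : 'S_m.+2) (i : nat) (j k : 'I_m.+2) :
  scores (sweep_guesses m) sigma = scores (sweep_guesses m) tau ->
  j = i :> nat -> k = i.+1 :> nat -> (2 * i.+1)%N != m.+2 ->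
  sigma j = tau j /\ sigma k = tau k.
Proof.
move=> /eq_in_map eq_sc ji ki i2.
have lt_i : (i.+1 < m.+2)%N by rewrite -ki.
have lt_i' := ltnW lt_i.
have jk : j != k by apply/eqP => jk; move: ki; rewrite -jk ji; lia.
(* Position [k], read as a residue, is also the gap between the two colours that sweep [c] exchanges
   here. *)
have per c : swap_gain sigma j k (c + k) - swap_gain sigma j k c =
             swap_gain tau j k (c + k) - swap_gain tau j k c.
  have [cj ck] : sweep c i j = c /\ sweep c i k = c + k.
    rewrite !sweepE !cycle_permE // ji ki ltnn eqxx addr0.
    by rewrite ltnNge leqnSn eqn_leq ltnn.
  have := eq_sc _ (mem_sweep_guesses c lt_i).
  have := eq_sc _ (mem_sweep_guesses c lt_i').
  have -> : sweep c i.+1 = (tperm j k * sweep c i)%g.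
    by rewrite sweepS -ki -ji !inord_val.
  move=> e1 e2; have := black_pegs_swap (sweep c i) sigma jk.
  by rewrite cj ck e1 e2 black_pegs_swap // cj ck => <-.
have k0 : k != 0 by apply/eqP => k0; move: ki; rewrite k0.
have kk0 : k + k != 0.
  (* As 0 < 2k < 2n, the only multiple of n that 2k could equal is n itself. *)
  apply/eqP => /(congr1 val) /= /eqP; rewrite -/(_ %| _)%N => /dvdnP[q].
  by rewrite ki; case: q => [|[|q]]; lia.
have neq_jk (rho : 'S_m.+2) : rho j != rho k by rewrite (inj_eq perm_inj).
split.
- apply: (@periodic_gain_eq _ k _ (sigma k) _ (tau k)) => // c.
  by have := per c; rewrite /swap_gain; lra.
(* Exchanging the two positions negates both gains, so periodicity persists. *)
- apply: (@periodic_gain_eq _ k _ (sigma j) _ (tau j)) => // [|c].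
    by rewrite eq_sym.
  by have := per c; rewrite /swap_gain; lra.
Qed.

Lemma correct_sweep_guesses (m : nat) :
  (2 <= m)%N -> correct_static (sweep_guesses m).
Proof.
move=> m2; apply/correct_staticP => sigma tau eq_sc; apply/permP => k.
have vi i : (i < m.+2)%N -> (inord i : 'I_m.+2) = i :> nat by exact: inordK.
have lt_k := ltn_ord k.
have [/andP[lt_k1 k2]|k_bad] := boolP ((k.+1 < m.+2) && (2 * k.+1 != m.+2))%N.
  by have [] := sweep_scores_eq eq_sc (erefl (k : nat)) (vi _ lt_k1) k2.
(* If [k] is last or 2(k + 1) = n, the left neighbour serves instead: the period becomes k, and 2k
   differs from n since n >= 4. *)
have k0 : (0 < k)%N by lia.
have k1 : k = k.-1.+1 :> nat by rewrite prednK.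
have lt_k1 : (k.-1 < m.+2)%N by lia.
have k12 : (2 * k.-1.+1)%N != m.+2 by lia.
by have [] := sweep_scores_eq eq_sc (vi _ lt_k1) k1 k12.
Qed.

Lemma static_length_sq (n : nat) : (4 <= n)%N -> static_length n 2 (n * n).
Proof.
case: n => [|[|m]] // m2; exists (sweep_guesses m); split.
- by rewrite size_mkseq.
- exact: window_local_sweep_guesses.
- exact: correct_sweep_guesses.
Qed.

Theorem theorem3 (R : realType) :
  exists c C : R, [/\ 0 < c, 0 < C &
    exists N : nat, forall n : nat, (N <= n)%N ->
      exists T : nat, S_w_is n 2 T /\
        c * n%:R ^+ 2 <= T%:R <= C * n%:R ^+ 2].
Proof.
exists 16^-1, 1; split; rewrite ?invr_gt0 //.
exists 4%N => n n4.
have ex_T : exists T, `[< static_length n 2 T >].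
  by exists (n * n)%N; apply/asboolP/static_length_sq.
case: (ex_minnP ex_T) => T /asboolP lenT minT; exists T; split.
  by split=> // T' lenT'; apply: minT; apply/asboolP.
rewrite mul1r mulrC ler_pdivrMr // -natrX -natrM !ler_nat mulnC.
by rewrite static_length_ge //= minT //; apply/asboolP/static_length_sq.
Qed.
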